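(* Let $D$ be a finite set of integers greater than $1$, let $\mathcal{A} = \{A_d : d \in D\}$ be a collection of arithmetic progressions with $A_d = a_d + d\mathbb{Z}$, let $p_1,\dots,p_n$ be the distinct prime factors of $Q = \mathrm{lcm}(D)$ in some fixed order, and let $\delta_1,\dots,\delta_n \in [0,1/2]$. With $M_i^{(1)}$, $M_i^{(2)}$, $N_i$, $Q_{i-1}$ and $\nu$ as defined in the context, for each $i \in \{1,\dots,n\}$, $$M_i^{(1)} \le \sum_{mp_i^j\in N_i,\; m\mid Q_{i-1}} p_i^{-j} \cdot \frac{\nu(m)}{m} \le \frac{1}{p_i-1} \prod_{j < i} \bigg( 1 + \frac{1}{(1-\delta_j)(p_j-1)} \bigg),$$ and $$M_i^{(2)} \le \sum_{\substack{m_1p_i^{j_1},\, m_2p_i^{j_2}\in N_i\\ m_1,m_2 \,\mid\, Q_{i-1}}} p_i^{-(j_1+j_2)} \cdot \frac{\nu( \mathrm{lcm}(m_1,m_2) )}{\mathrm{lcm}(m_1,m_2)} \le \frac{1}{(p_i-1)^2}\prod_{j < i} \bigg( 1 + \frac{3p_j-1}{(1-\delta_j)(p_j-1)^2} \bigg).$$ (Each element of $N_i$ is written uniquely as $mp_i^j$ with $m \mid Q_{i-1}$ and $j\ge 1$; the second sum is over ordered pairs of elements of $N_i$.)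
   Context: Write $\mathbb{Z}_m = \mathbb{Z}/m\mathbb{Z}$ and $Q = \prod_{j=1}^n p_j^{\gamma_j}$ with $\gamma_j \ge 1$. For $0 \le i \le n$ put $Q_i = \prod_{j \le i} p_j^{\gamma_j}$ (so $Q_0 = 1$) and $D_i = \{d \in D : d \mid Q_i\}$; for $1\le i\le n$ put $N_i = D_i \setminus D_{i-1}$ and $B_i = \bigcup_{d \in N_i} A_d$. Sets of integers that are periodic mod $Q$ are identified with subsets of $\mathbb{Z}_Q$. A probability measure on $\mathbb{Z}_{Q_i}$ is extended to $\mathbb{Z}_Q$ by spreading the mass of each congruence class mod $Q_i$ uniformly over that class. $\mathbb{P}_0$ is the uniform measure on $\mathbb{Z}_Q$. Given $\mathbb{P}_{i-1}$ on $\mathbb{Z}_{Q_{i-1}}$, identify $\mathbb{Z}_{Q_i}$ with $\mathbb{Z}_{Q_{i-1}} \times \mathbb{Z}_{p_i^{\gamma_i}}$ (Chinese Remainder Theorem), write its elements as $(x,y)$, set for $x \in \mathbb{Z}_{Q_{i-1}}$ $$\alpha_i(x) = \frac{|\{ y \in \mathbb{Z}_{p_i^{\gamma_i}} : (x,y) \in B_i \}|}{p_i^{\gamma_i}},$$ and define $\mathbb{P}_i$ on $\mathbb{Z}_{Q_i}$ by $$\mathbb{P}_i(x,y) = \begin{cases} \max\Big\{0, \dfrac{\alpha_i(x)-\delta_i}{\alpha_i(x)(1-\delta_i)}\Big\}\cdot \mathbb{P}_{i-1}(x,y) & \text{if } (x,y) \in B_i,\\[2ex] \min\Big\{\dfrac{1}{1-\alpha_i(x)},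 \dfrac{1}{1-\delta_i}\Big\} \cdot \mathbb{P}_{i-1}(x,y) & \text{if } (x,y) \notin B_i.\end{cases}$$ $\mathbb{E}_i$ denotes expectation with respect to $\mathbb{P}_i$ (on $\mathbb{Z}_Q$); $\alpha_i$ is viewed as a function on $\mathbb{Z}_Q$ via reduction mod $Q_{i-1}$. Set $M_i^{(1)} = \mathbb{E}_{i-1}[\alpha_i(x)]$, $M_i^{(2)} = \mathbb{E}_{i-1}[\alpha_i(x)^2]$, and for $d \mid Q$, $\nu(d) = \prod_{p_j \mid d} \frac{1}{1-\delta_j}$. *)

(* Defs.v *)
From HB Require Import structures.
From mathcomp Require Import all_boot all_order all_algebra.
From mathcomp Require Import finmap.
Set Implicit Arguments.
Unset Strict Implicit.
Unset Printing Implicit Defensive.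
Import Order.TTheory GRing.Theory Num.Theory.
Local Open Scope ring_scope.

(* Conventions: the primes p and the parameters delta are indexed from 1 to n  *)
(* (values at other indices are never used); the ring Z/mZ is represented by  *)
(* 'I_m, and a measure on Z/mZ by its mass function 'I_m -> R; a set of        *)
(* integers periodic mod m is evaluated on Z/mZ at the representatives in 'I_m.*)

Section Distortion.

Variables (R : realFieldType) (D : {fset nat}) (a : nat -> int) (n : nat).
Variables (p : nat -> nat) (delta : nat -> R).

Definition AP (d : nat) : pred int := fun x => (x == a d %[mod d])%Z.

Definition Qfull : nat := \big[lcmn/1%N]_(d <- D) d.

Definition gamma (j : nat) : nat := logn (p j) Qfull.

Definition Qpart (i : nat) : nat := (\prod_(1 <= j < i.+1) p j ^ gamma j)%N.

(* No primality is needed: logn q m = 0 when q is not prime. *)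
Lemma Qpart_gt0 (i : nat) : (0 < Qpart i)%N.
Proof. by apply: prodn_gt0 => j; apply: pfactor_gt0. Qed.

Definition Dpart (i : nat) : {fset nat} := [fset d in D | (d %| Qpart i)%N]%fset.

Definition Npart (i : nat) : {fset nat} := (Dpart i `\` Dpart i.-1)%fset.

Definition Bpart (i : nat) : pred int :=
  fun x => has (fun d => AP d x) (Npart i).

Definition residue (i : nat) (z : nat) : 'I_(Qpart i) :=
  Ordinal (ltn_pmod z (Qpart_gt0 i)).

(* The mass of each class mod Q_i is shared equally among the m / Q_i classes *)
(* mod m contained in it; used when Q_i divides m.                            *)
Definition spread (i m : nat) (mu : 'I_(Qpart i) -> R) : 'I_m -> R :=
  fun z => mu (residue i z) / (m %/ Qpart i)%:R.

(* chinese m1 m2 x y is a representative of the pair (x, y). *)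
Definition alpha (i : nat) (x : 'I_(Qpart i.-1)) : R :=
  #|[set y : 'I_(p i ^ gamma i) |
      Bpart i (chinese (Qpart i.-1) (p i ^ gamma i) x y)%:Z]|%:R
  / (p i ^ gamma i)%:R.

(* The junk value 0^-1 = 0 is harmless: alpha i x <> 0 if the fibre of x meets *)
(* Bpart i, and alpha i x <> 1 if the fibre of x is not contained in Bpart i.  *)
Definition distort (i : nat) (mu : 'I_(Qpart i.-1) -> R) : 'I_(Qpart i) -> R :=
  fun z =>
    let al := alpha (residue i.-1 z) in
    (if Bpart i z%:Z
     then Num.max 0 ((al - delta i) / (al * (1 - delta i)))
     else Num.min (1 / (1 - al)) (1 / (1 - delta i)))
    * spread mu z.

(* Since Q_0 = 1, the measure of stage 0 lives on one point, and its extension *)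
(* to Z/QZ is the uniform measure.                                             *)
Fixpoint Pm (i : nat) : 'I_(Qpart i) -> R :=
  match i return 'I_(Qpart i) -> R with
  | 0%N => fun=> 1
  | k.+1 => @distort k.+1 (@Pm k)
  end.

Definition PQ (i : nat) : 'I_Qfull -> R := spread (@Pm i).

Definition expect (i : nat) (f : 'I_Qfull -> R) : R :=
  \sum_(z < Qfull) f z * PQ i z.

Definition M1 (i : nat) : R :=
  expect i.-1 (fun z => alpha (residue i.-1 z)).

Definition M2 (i : nat) : R :=
  expect i.-1 (fun z => alpha (residue i.-1 z) ^+ 2).

Definition nu (d : nat) : R :=
  \prod_(1 <= j < n.+1 | (p j %| d)%N) (1 / (1 - delta j)).

Lemma PQ0 (z : 'I_Qfull) : PQ 0 z = 1 / Qfull%:R.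
Proof. by rewrite /PQ /spread /= /Qpart big_geq // divn1. Qed.

Lemma coprime_Qpart (i : nat) :
    perm_eq [seq p j | j <- iota 1 n] (primes Qfull) -> (1 <= i <= n)%N ->
  prime (p i) /\ coprime (Qpart i.-1) (p i).
Proof.
move=> pP /andP[i_gt0 le_in].
have p_pr j : (1 <= j <= n)%N -> prime (p j).
  case/andP=> j_gt0 le_jn.
  have: p j \in primes Qfull.
    by rewrite -(perm_mem pP) map_f // mem_iota j_gt0 add1n ltnS.
  by rewrite mem_primes => /and3P[].
have pi_pr : prime (p i) by apply: p_pr; rewrite i_gt0.
split=> //; rewrite /Qpart prednK // big_nat_cond.
elim/big_rec: _ => [|j y]; first exact: coprime1n.
rewrite andbT => /andP[j_gt0 lt_ji] co_y.
rewrite coprimeMl co_y andbT coprimeXl // prime_coprime ?dvdn_prime2 //;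
  try by apply: p_pr; rewrite j_gt0 (leq_trans (ltnW lt_ji)).
have le_jn := leq_trans (ltnW lt_ji) le_in.
have uniq_p : uniq [seq p j | j <- iota 1 n].
  by rewrite (perm_uniq pP) primes_uniq.
apply/eqP=> eq_p.
have := uniqP 0%N uniq_p j.-1 i.-1.
rewrite !inE !size_map size_iota !prednK // => /(_ le_jn le_in).
rewrite !(nth_map 0%N) ?size_iota ?prednK // !nth_iota ?prednK //.
rewrite !add1n !prednK // => /(_ eq_p) eq_ji.
by move: lt_ji; rewrite -(prednK j_gt0) eq_ji prednK // ltnn.
Qed.

(* This is why the sums over Npart i may be indexed by pairs (m, j) with m a  *)
(* divisor of Qpart i.-1 and 1 <= j <= gamma i.                               *)
Lemma Npart_decomp (i d : nat) :
    perm_eq [seq p j | j <- iota 1 n] (primes Qfull) -> (1 <= i <= n)%N ->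
    d \in Npart i ->
  exists m j : nat,
    [/\ (m %| Qpart i.-1)%N, (1 <= j <= gamma i)%N, d = (m * p i ^ j)%N &
        forall m' j' : nat,
          (m' %| Qpart i.-1)%N -> d = (m' * p i ^ j')%N -> m' = m /\ j' = j].
Proof.
move=> pP i_bd; have [p_pr co_p] := coprime_Qpart pP i_bd.
have /andP[i_gt0 _] := i_bd.
rewrite !inE /= => /andP[nd /andP[dD dQ]].
have QE : Qpart i = (Qpart i.-1 * p i ^ gamma i)%N.
  by rewrite /Qpart prednK // big_nat_recr.
have d_gt0 : (0 < d)%N := dvdn_gt0 (Qpart_gt0 i) dQ.
have [m co_m dE] := pfactor_coprime p_pr d_gt0.
rewrite coprime_sym in co_m.
have mQ : (m %| Qpart i.-1)%N.
  rewrite -(@Gauss_dvdl _ _ (p i ^ gamma i)) ?coprimeXr // -QE.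
  by apply: dvdn_trans dQ; rewrite dE dvdn_mulr.
have j_gt0 : (0 < logn (p i) d)%N.
  rewrite lt0n; apply/eqP=> j0; move: nd; rewrite dD /=.
  by rewrite dE j0 muln1 mQ.
exists m, (logn (p i) d); split=> //.
  rewrite j_gt0 /= -(@dvdn_Pexp2l (p i)) ?prime_gt1 //.
  rewrite -(@Gauss_dvdr _ (Qpart i.-1)) -?QE.
    by rewrite (dvdn_trans _ dQ) // pfactor_dvdnn.
  by rewrite coprimeXl // coprime_sym.
move=> m' j' m'Q dE'.
have co_m' : coprime (p i) m'.
  by rewrite coprime_sym (coprime_dvdl m'Q).
have m'_gt0 := dvdn_gt0 (Qpart_gt0 i.-1) m'Q.
have j'E : j' = logn (p i) d.
  have pj_gt0 : (0 < p i ^ j')%N by rewrite expn_gt0 prime_gt0.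
  by rewrite dE' (lognM _ m'_gt0 pj_gt0) (pfactorK _ p_pr) (logn_coprime co_m').
split=> //; apply/eqP; rewrite -(@eqn_pmul2r (p i ^ j')) ?expn_gt0 ?prime_gt0 //.
by rewrite -dE' {1}dE j'E.
Qed.

End Distortion.

(* Main.v *)
(* The distortion keeps the mass of every fibre of Z/Q_k -> Z/Q_(k-1), and    *)
(* multiplies point masses by at most 1 / (1 - delta_k).  By induction on k,  *)
(* a progression modulo d | Q_k therefore has P_k-measure at most nu(d) / d.  *)
(* A union bound over N_i bounds alpha_i(x) by the sum of p_i^-j over those   *)
(* m p_i^j in N_i whose progression meets the fibre of x; integrating it, or  *)
(* its square, against P_(i-1) gives the first inequalities, as two           *)
(* progressions mod m1 and m2 meet in a progression mod lcm(m1, m2) or not at *)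
(* all.  Dropping the condition m p_i^j in N_i makes the sums factor as Euler *)
(* products, whose local factors are geometric series.                        *)
Require Import Defs.
From HB Require Import structures.
From mathcomp Require Import all_boot all_order all_algebra.
From mathcomp Require Import finmap.
From mathcomp Require Import zify ring lra.
Set Implicit Arguments.
Unset Strict Implicit.
Unset Printing Implicit Defensive.
Import Order.TTheory GRing.Theory Num.Theory.
Local Open Scope ring_scope.

(** Two facts about one step of the construction carry the probabilistic half. The weights average
    to 1 over each fibre ([distort_weights_mean], hence [Pm_marginal]), and they never exceed 1 / (1
    - delta_k) ([distort_weight_bounds], hence [PmS_le]). Together they give [Pm_AP_le], where a
    prime costs a factor 1 / (1 - delta_k) only if it divides the modulus. Since the union bound
    [alpha_le] is linear in indicators of progressions, the first moment needs the measure of one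
    progression and the second that of an intersection of two ([Pm_AP2_le]). The upper bounds are
    arithmetic: m |-> nu(m) / m is multiplicative, so sums over all divisors of Q_k split into one
    factor per prime ([sum_nu_ratio_le], [sum_nu_ratio_lcm_le]). In the lcm sum an exponent r arises
    as a maximum from 2 r + 1 pairs, and the series of (2 r + 1) q^-r over r >= 1 equals (3 q - 1) /
    (q - 1)^2. *)

(** * Residue classes and the Chinese Remainder Theorem *)

Lemma sum_modn (V : nmodType) (k q : nat) (G : nat -> V) :
  \sum_(z < k * q) G (z %% q)%N = (\sum_(x < q) G x) *+ k.
Proof.
elim: k => [|k IH]; first by rewrite big_ord0.
rewrite -[LHS](big_mkord xpredT (fun z => G (z %% q)%N)).
rewrite (big_cat_nat (leq0n (k * q)%N)) ?leq_mul2r ?leqnSn ?orbT //=.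
rewrite big_mkord IH mulrSr -[X in \sum_(X <= _ < _) _]addn0 addnC.
rewrite big_addn mulSn addnK big_mkord; congr (_ + _).
by apply: eq_bigr => x _; rewrite addnC modnMDl modn_small.
Qed.

Lemma sum_chinese (V : nmodType) (a b : nat) (F : nat -> V) :
  (0 < a)%N -> (0 < b)%N -> coprime a b ->
  \sum_(z < a * b) F z
    = \sum_(x < a) \sum_(y < b) F (chinese a b x y %% (a * b))%N.
Proof.
move=> a_gt0 b_gt0 co_ab.
pose h (z : 'I_(a * b)) : 'I_a * 'I_b :=
  (Ordinal (ltn_pmod z a_gt0), Ordinal (ltn_pmod z b_gt0)).
have hK (z : 'I_(a * b)) :
    (chinese a b (h z).1 (h z).2 %% (a * b))%N = z.
  by rewrite -chinese_mod // modn_small.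
have h_inj : injective h.
  by move=> z1 z2 eq_h; apply: val_inj; rewrite /= -(hK z1) -(hK z2) eq_h.
have h_bij : bijective h.
  by apply: inj_card_bij h_inj _; rewrite card_prod !card_ord.
rewrite pair_bigA /= (reindex h) /=; last exact: onW_bij.
by apply: eq_bigr => z _; rewrite hK.
Qed.

Lemma sum_residue_class (R : nzSemiRingType) (N d c : nat) :
  (0 < d)%N -> (d %| N)%N ->
  \sum_(y < N) (y == c %[mod d])%:R = (N %/ d)%:R :> R.
Proof.
move=> d_gt0 /dvdnP[k ->]; rewrite mulnK //.
rewrite [LHS](sum_modn k d (fun y => (y == c %% d)%N%:R)); congr (_ *+ _).
rewrite (bigD1 (Ordinal (ltn_pmod c d_gt0))) //= eqxx big1 ?addr0 // => y.
by rewrite -val_eqE /= => /negPf ->.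
Qed.

Lemma eqn_mod_lcm (m1 m2 x y : nat) :
  (x == y %[mod lcmn m1 m2]) = (x == y %[mod m1]) && (x == y %[mod m2]).
Proof.
wlog le_yx: x y / (y <= x)%N => [IH|]; last by rewrite !eqn_mod_dvd // dvdn_lcm.
by case: (leqP y x) => [|/ltnW] /IH // H; rewrite ![_ == (y %% _)%N]eq_sym H.
Qed.

(** * Divisors and least common multiples when a new prime power is split off *)

(** The exponent t is recovered as the q-adic valuation of d, and m as the cofactor. This drives the
    induction on the number of primes, both for splitting a modulus and for factoring divisor
    sums. *)
Lemma perm_divisorsM (u q g : nat) : (0 < u)%N -> prime q -> coprime u q ->
  perm_eq (divisors (u * q ^ g))
          [seq (m * q ^ t)%N | m <- divisors u, t <- iota 0 g.+1].
Proof.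
move=> u_gt0 q_pr co_uq; have q_gt0 := prime_gt0 q_pr.
have uq_gt0 : (0 < u * q ^ g)%N by rewrite muln_gt0 u_gt0 expn_gt0 q_gt0.
apply: uniq_perm; first exact: divisors_uniq.
  apply: allpairs_uniq; rewrite ?divisors_uniq ?iota_uniq //.
  move=> _ _ /allpairsP[[m1 t1] [m1u _ ->]] /allpairsP[[m2 t2] [m2u _ ->]] /= E.
  move: m1u m2u; rewrite -!dvdn_divisors // => m1u m2u.
  have lE m t : (m %| u)%N -> logn q (m * q ^ t) = t.
    move=> mu; rewrite lognM ?expn_gt0 ?q_gt0 ?(dvdn_gt0 u_gt0 mu) //.
    by rewrite pfactorK // logn_coprime // coprime_sym (coprime_dvdl mu).
  have Et : t1 = t2 by rewrite -(lE m1 t1 m1u) E lE.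
  move/eqP: E; rewrite Et eqn_pmul2r ?expn_gt0 ?q_gt0 // => /eqP -> //.
move=> d; rewrite -dvdn_divisors //; apply/idP/allpairsP => [dv|[[m t] [mu]]].
  have d_gt0 := dvdn_gt0 uq_gt0 dv.
  have [m co_m dE] := pfactor_coprime q_pr d_gt0.
  rewrite coprime_sym in co_m.
  exists (m, logn q d); split; last exact: dE.
    rewrite -dvdn_divisors // -(@Gauss_dvdl _ _ (q ^ g)) ?coprimeXr //.
    by apply: dvdn_trans dv; rewrite dE dvdn_mulr.
  rewrite mem_iota leq0n add0n ltnS -(@dvdn_Pexp2l q) ?prime_gt1 //.
  rewrite -(@Gauss_dvdr _ u); last by rewrite coprimeXl // coprime_sym.
  by rewrite (dvdn_trans _ dv) // pfactor_dvdnn.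
rewrite -dvdn_divisors // in mu; rewrite mem_iota add0n ltnS => tg ->.
by rewrite dvdn_mul // dvdn_exp2l.
Qed.

Lemma sum_divisorsM (V : nmodType) (u q g : nat) (F : nat -> V) :
  (0 < u)%N -> prime q -> coprime u q ->
  \sum_(d <- divisors (u * q ^ g)) F d
    = \sum_(m <- divisors u) \sum_(0 <= t < g.+1) F (m * q ^ t)%N.
Proof.
move=> u_gt0 q_pr co_uq.
by rewrite (perm_big _ (perm_divisorsM g u_gt0 q_pr co_uq)) big_allpairs_dep.
Qed.

(** The lcm takes the larger exponent at q and does not mix with the part prime to q, so double sums
    over lcms factor prime by prime. *)
Lemma lcmn_coprimeMX (u q m1 m2 s t : nat) :
  (0 < u)%N -> coprime u q -> (m1 %| u)%N -> (m2 %| u)%N ->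
  lcmn (m1 * q ^ s) (m2 * q ^ t) = (lcmn m1 m2 * q ^ maxn s t)%N.
Proof.
move=> u_gt0 co_uq m1u m2u.
have co_m m e : (m %| u)%N -> coprime m (q ^ e).
  by move=> mu; rewrite coprimeXr // (coprime_dvdl mu).
have m12u : (lcmn m1 m2 %| u)%N by rewrite dvdn_lcm m1u.
apply/eqP; rewrite eqn_dvd dvdn_lcm !dvdn_mul ?dvdn_lcml ?dvdn_lcmr ?dvdn_exp2l
  ?leq_maxl ?leq_maxr //= Gauss_dvd ?co_m // dvdn_lcm.
rewrite (dvdn_trans (dvdn_mulr _ _) (dvdn_lcml _ _)) //=.
rewrite (dvdn_trans (dvdn_mulr _ _) (dvdn_lcmr _ _)) //=.
case: (leqP s t) => [|/ltnW] _.
  by rewrite (dvdn_trans (dvdn_mull _ _) (dvdn_lcmr _ _)).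
by rewrite (dvdn_trans (dvdn_mull _ _) (dvdn_lcml _ _)).
Qed.

(** * Geometric series for the local factors *)

Lemma geo_sum_le (R : realFieldType) (q : R) (g : nat) : 1 < q ->
  \sum_(1 <= t < g.+1) q ^- t <= 1 / (q - 1).
Proof.
move=> q_gt1.
have q1 : q - 1 != 0 by lra.
have q0 : q != 0 by lra.
suff -> : \sum_(1 <= t < g.+1) q ^- t = 1 / (q - 1) - q ^- g / (q - 1).
  by rewrite gerBl divr_ge0 ?invr_ge0 ?exprn_ge0 //; lra.
elim: g => [|g IH]; first by rewrite big_geq // expr0; field.
rewrite big_nat_recr //= IH exprS.
have qg : q ^+ g != 0 by rewrite expf_neq0.
by field; rewrite q1 q0 qg.
Qed.

Lemma geo_sum_odd_le (R : realFieldType) (q : R) (g : nat) : 1 < q ->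
  \sum_(1 <= r < g.+1) (r.*2.+1)%:R * q ^- r <= (3 * q - 1) / (q - 1) ^+ 2.
Proof.
move=> q_gt1.
have q1 : q - 1 != 0 by lra.
have q0 : q != 0 by lra.
(* The infinite series is 2 q / (q - 1)^2 + 1 / (q - 1) = (3 q - 1) / (q - 1)^2. The subtracted term
   is its tail beyond g, obtained by shifting r by g, and is nonnegative. *)
suff -> : \sum_(1 <= r < g.+1) (r.*2.+1)%:R * q ^- r
   = (3 * q - 1) / (q - 1) ^+ 2
     - q ^- g * ((3 * q - 1) / (q - 1) ^+ 2 + 2 * g%:R / (q - 1)).
  rewrite gerBl mulr_ge0 ?invr_ge0 ?exprn_ge0 //; first lra.
  by rewrite addr_ge0 ?divr_ge0 ?sqr_ge0 ?mulr_ge0 ?ler0n //; lra.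
elim: g => [|g IH]; first by rewrite big_geq // expr0; field.
rewrite big_nat_recr //= IH (exprS q g) -mul2n -[(2 * _).+1]addn1 natrD natrM.
rewrite -[g.+1%:R]natr1.
have qg : q ^+ g != 0 by rewrite expf_neq0.
by field; rewrite q1 q0 qg.
Qed.

(* Among pairs in [0, g]^2, exactly [2 r + 1] have maximum [r]. *)
Lemma sum_maxn (V : nmodType) (g : nat) (F : nat -> V) :
  \sum_(0 <= s < g.+1) \sum_(0 <= t < g.+1) F (maxn s t)
    = \sum_(0 <= r < g.+1) F r *+ r.*2.+1.
Proof.
elim: g => [|g IH]; first by rewrite !big_nat1 maxnn.
rewrite [RHS]big_nat_recr //= -IH big_nat_recr //=.
under eq_big_nat => s /andP[_ sg].
  rewrite big_nat_recr //= (maxn_idPr (ltnW sg)); over.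
rewrite big_split /= -addrA; congr (_ + _).
rewrite sumr_const_nat subn0 (_ : \sum_(_ <= t < _) _ = F g.+1 *+ g.+2).
  by rewrite -mulrnDr; congr (_ *+ _); lia.
rewrite -[g.+2 in RHS]subn0 -sumr_const_nat.
by apply: eq_big_nat => t /andP[_ tg]; rewrite (maxn_idPl _).
Qed.

(** * Comparison of finite sums *)

Lemma ler_sum_term (R : numDomainType) (I : eqType) (r : seq I) (P : pred I)
    (F : I -> R) (x : I) :
  (forall y, P y -> 0 <= F y) -> x \in r -> P x -> F x <= \sum_(y <- r | P y) F y.
Proof.
move=> F_ge0 xr Px; rewrite (big_rem x) //= Px lerDl.
by rewrite sumr_ge0.
Qed.

Lemma ler_sum_subset (S : numDomainType) (I : Type) (r : seq I) (A : pred I)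
    (F : I -> S) :
  (forall x, 0 <= F x) -> \sum_(x <- r | A x) F x <= \sum_(x <- r) F x.
Proof.
move=> F_ge0; rewrite big_mkcond /=; apply: ler_sum => x _.
by case: ifP.
Qed.

Lemma ler_sum_seq (R : numDomainType) (I : eqType) (r : seq I) (F G : I -> R) :
  {in r, forall x, F x <= G x} -> \sum_(x <- r) F x <= \sum_(x <- r) G x.
Proof.
by move=> leFG; rewrite big_seq [leRHS]big_seq; apply: ler_sum => x /leFG.
Qed.

(** * The distortion weights *)

(** A proportion [al] of the fibre lies in B and gets the first weight, the rest gets the second;
    mean 1 is what preserves the mass of the fibre. *)
Lemma distort_weights_mean (R : realFieldType) (al de : R) :
    0 <= al <= 1 -> 0 <= de < 1 ->
  Num.max 0 ((al - de) / (al * (1 - de))) * al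
    + Num.min (1 / (1 - al)) (1 / (1 - de)) * (1 - al) = 1.
Proof.
move=> /andP[al_ge0 al_le1] /andP[de_ge0 de_lt1].
have de'_neq0 : 1 - de != 0 by lra.
have [->|al_neq0] := eqVneq al 0.
  rewrite mulr0 add0r subr0 mulr1 divr1 min_l //.
  by rewrite ler_pdivlMr; lra.
have [->|al_neq1] := eqVneq al 1.
  by rewrite subrr !mulr0 mul1r divff // max_r ?ler01 // mulr1 addr0.
have al_gt0 : 0 < al by rewrite lt_def al_neq0.
have al_lt1 : al < 1 by rewrite lt_def eq_sym al_neq1.
have al'_neq0 : 1 - al != 0 by lra.
(* If de <= al, both weights have denominator 1 - de and the numerators add up to (al - de) + (1 -
   al). If al < de, B loses all its mass and the complement is rescaled by 1 / (1 - al). *)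
have [le_de|lt_de] := leP de al.
  rewrite max_r ?divr_ge0 ?mulr_ge0 //; try lra.
  rewrite min_r; last by rewrite !div1r lef_pV2 ?posrE; lra.
  by field; rewrite al_neq0 de'_neq0.
rewrite max_l; last first.
  by rewrite ler_pdivrMr ?mul0r ?mulr_gt0; lra.
rewrite min_l; last by rewrite !div1r lef_pV2 ?posrE; lra.
by field.
Qed.

Lemma distort_weight_bounds (R : realFieldType) (al de : R) (b : bool) :
    0 <= al <= 1 -> 0 <= de < 1 ->
  0 <= (if b then Num.max 0 ((al - de) / (al * (1 - de)))
        else Num.min (1 / (1 - al)) (1 / (1 - de))) <= 1 / (1 - de).
Proof.
move=> /andP[al_ge0 al_le1] /andP[de_ge0 de_lt1].
have de'_ge0 : 0 <= 1 / (1 - de) by rewrite divr_ge0; lra.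
case: b; last by rewrite ge_min lexx orbT le_min de'_ge0 andbT divr_ge0; lra.
rewrite le_max lexx /= ge_max de'_ge0 /=.
have [->|al_neq0] := eqVneq al 0; first by rewrite mul0r invr0 mulr0.
have al_gt0 : 0 < al by rewrite lt_def al_neq0.
rewrite ler_pdivrMr ?mulr_gt0; [|lra..].
by rewrite mulrCA mul1r mulVf; lra.
Qed.

(** * The tower of moduli Q_k *)

Section Distortion.

Variables (R : realFieldType) (D : {fset nat}) (a : nat -> int) (n : nat).
Variables (p : nat -> nat) (delta : nat -> R).
Hypothesis p_primes : perm_eq [seq p j | j <- iota 1 n] (primes (Qfull D)).
Hypothesis delta_bounds : forall j : nat, (1 <= j <= n)%N -> 0 <= delta j <= 1 / 2.

Local Notation Q := (Qpart D p).
Local Notation gam := (gamma D p).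
Local Notation P k := (@Pm R D a p delta k).
Local Notation h m := (nu n p delta m / m%:R).

Lemma delta_lt1 j : (1 <= j <= n)%N -> 0 <= delta j < 1.
Proof. by move=> /delta_bounds /andP[? ?]; apply/andP; lra. Qed.

Lemma prime_p j : (1 <= j <= n)%N -> prime (p j).
Proof. by case/(coprime_Qpart p_primes). Qed.

Lemma p_gt1 j : (1 <= j <= n)%N -> 1 < (p j)%:R :> R.
Proof. by move=> /prime_p /prime_gt1; rewrite ltr1n. Qed.

Lemma p_inj j k : (1 <= j <= n)%N -> (1 <= k <= n)%N -> p j = p k -> j = k.
Proof.
have uniq_p : uniq [seq p j | j <- iota 1 n].
  by rewrite (perm_uniq p_primes) primes_uniq.
have nthE m : (1 <= m <= n)%N -> p m = nth 0%N [seq p j | j <- iota 1 n] m.-1.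
  case: m => // m lt_mn; rewrite (nth_map 0%N) ?size_iota // nth_iota //.
case: j k => [|j] [|k] // lt_jn lt_kn; rewrite !nthE // => /eqP.
by rewrite nth_uniq ?size_map ?size_iota // => /eqP /= ->.
Qed.

Lemma coprime_QpartS k : (k < n)%N -> coprime (Q k) (p k.+1).
Proof. by move=> lt_kn; case: (@coprime_Qpart D n p k.+1 p_primes lt_kn). Qed.

Lemma QpartS k : Q k.+1 = (Q k * p k.+1 ^ gam k.+1)%N.
Proof. by rewrite /Qpart big_nat_recr. Qed.

Lemma Qpart_dvd_Qfull k : (k <= n)%N -> (Q k %| Qfull D)%N.
Proof.
elim: k => [|k IH] lt_kn; first by rewrite /Qpart big_geq // dvd1n.
rewrite QpartS Gauss_dvd ?coprimeXr ?coprime_QpartS //.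
by rewrite IH 1?ltnW //= pfactor_dvdnn.
Qed.

Lemma fibre_gt0 k : (k < n)%N -> (0 < p k.+1 ^ gam k.+1)%N.
Proof. by move=> lt_kn; rewrite expn_gt0 prime_gt0 // prime_p. Qed.

(** * Progressions and residues in Chinese Remainder coordinates *)

(** The natural representative of a_d mod d, which turns membership in A_d into a congruence of
    natural numbers. *)
Let c d : nat := `|(a d %% d)%Z|%N.

Lemma AP_nat d z : (0 < d)%N -> AP a d z%:Z = (z == c d %[mod d])%N.
Proof.
move=> d_gt0; have d_neq0 : d%:Z != 0 by rewrite -lt0n.
have cE : (c d)%:Z = (a d %% d)%Z by rewrite /c gez0_abs // modz_ge0.
have c_lt : (c d < d)%N by rewrite -ltz_nat cE ltz_pmod.
by rewrite /AP modz_nat -cE eqz_nat [(c d %% d)%N]modn_small.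
Qed.

Lemma Bpart_modn k z : Bpart D a p k (z %% Q k)%N%:Z = Bpart D a p k z%:Z.
Proof.
apply: eq_in_has => d; rewrite !inE => /andP[_ /andP[_ dQ]].
have d_gt0 := dvdn_gt0 (Qpart_gt0 D p k) dQ.
by rewrite !AP_nat // modn_dvdm.
Qed.

Lemma residue_modn k z : residue D p k (z %% Q k) = residue D p k z.
Proof. by apply: val_inj; rewrite /= modn_mod. Qed.

Lemma residue_ord k (x : 'I_(Q k)) : residue D p k x = x.
Proof. by apply: val_inj; rewrite /= modn_small. Qed.

Lemma residue_residueS k z : residue D p k (residue D p k.+1 z) = residue D p k z.
Proof. by apply: val_inj; rewrite /= modn_dvdm // QpartS dvdn_mulr. Qed.

Local Notation crt k x y := (chinese (Q k) (p k.+1 ^ gam k.+1) x y).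

Lemma residue_crt k (x : 'I_(Q k)) y : (k < n)%N -> residue D p k (crt k x y) = x.
Proof.
move=> lt_kn; apply: val_inj.
by rewrite /= chinese_modl ?coprimeXr ?coprime_QpartS // modn_small.
Qed.

(** The condition on x and the condition on y become independent, so a progression is a product set
    in Z/Q_k x Z/p^gamma. *)
Lemma crt_modn k (x : 'I_(Q k)) y m t e : (k < n)%N -> (m %| Q k)%N ->
    (t <= gam k.+1)%N ->
  (crt k x y == e %[mod m * p k.+1 ^ t])%N
    = (x == e %[mod m])%N && (y == e %[mod p k.+1 ^ t])%N.
Proof.
move=> lt_kn mQ le_t; have co := coprime_QpartS lt_kn.
rewrite chinese_remainder; last by rewrite coprimeXr // (coprime_dvdl mQ).
have coX : coprime (Q k) (p k.+1 ^ gam k.+1) by rewrite coprimeXr.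
rewrite -(modn_dvdm (crt k x y) mQ) chinese_modl // modn_dvdm //.
have tg : (p k.+1 ^ t %| p k.+1 ^ gam k.+1)%N by rewrite dvdn_exp2l.
by rewrite -(modn_dvdm (crt k x y) tg) chinese_modr // modn_dvdm.
Qed.

Lemma sum_QpartS (V : nmodType) k (F : 'I_(Q k.+1) -> V) : (k < n)%N ->
  \sum_z F z
    = \sum_(x < Q k) \sum_(y < p k.+1 ^ gam k.+1) F (residue D p k.+1 (crt k x y)).
Proof.
move=> lt_kn; have := sum_chinese (fun z => F (residue D p k.+1 z))
  (Qpart_gt0 D p k) (fibre_gt0 lt_kn) (coprimeXr _ (coprime_QpartS lt_kn)).
rewrite -QpartS; under eq_bigr do rewrite residue_ord.
by move=> ->; do 2!apply: eq_bigr => ? _; rewrite residue_modn.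
Qed.

(** * The densities alpha_k and the measures P_k *)

Lemma alpha_bounds k x : 0 <= @alpha R D a p k x <= 1.
Proof.
rewrite /alpha; apply/andP; split; first by rewrite divr_ge0.
have [->|N0] := eqVneq (p k ^ gam k)%N 0%N; first by rewrite invr0 mulr0.
rewrite ler_pdivrMr ?ltr0n ?lt0n // mul1r ler_nat.
by rewrite -[X in (_ <= X)%N]card_ord max_card.
Qed.

Lemma alphaE k (x : 'I_(Q k)) : (k < n)%N ->
  @alpha R D a p k.+1 x
    = \sum_(y < p k.+1 ^ gam k.+1)
        (Bpart D a p k.+1 (crt k x y)%:Z)%:R / (p k.+1 ^ gam k.+1)%:R.
Proof.
move=> lt_kn; rewrite -mulr_suml /alpha; congr (_ / _).
by rewrite -natr_sum -big_mkcond /= sum1dep_card.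
Qed.

Lemma PmS k (x : 'I_(Q k)) y : (k < n)%N ->
  P k.+1 (residue D p k.+1 (crt k x y))
    = (let al := @alpha R D a p k.+1 x in
       if Bpart D a p k.+1 (crt k x y)%:Z
       then Num.max 0 ((al - delta k.+1) / (al * (1 - delta k.+1)))
       else Num.min (1 / (1 - al)) (1 / (1 - delta k.+1)))
      * (P k x / (p k.+1 ^ gam k.+1)%:R).
Proof.
move=> lt_kn; rewrite [LHS]/= /distort /spread.
rewrite residue_residueS residue_crt // Bpart_modn.
by rewrite QpartS mulKn ?Qpart_gt0.
Qed.

Lemma Pm_ge0 k x : (k <= n)%N -> 0 <= P k x :> R.
Proof.
elim: k x => [|k IH] x lt_kn; first exact: ler01.
rewrite /= /distort /spread mulr_ge0 ?divr_ge0 ?IH 1?ltnW //.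
by have /andP[] := distort_weight_bounds (Bpart D a p k.+1 x%:Z)
  (@alpha_bounds k.+1 (residue D p k x)) (@delta_lt1 k.+1 lt_kn).
Qed.

Lemma PmS_le k (x : 'I_(Q k)) y : (k < n)%N ->
  P k.+1 (residue D p k.+1 (crt k x y))
    <= 1 / (1 - delta k.+1) * (P k x / (p k.+1 ^ gam k.+1)%:R).
Proof.
move=> lt_kn; rewrite PmS //= ler_wpM2r ?divr_ge0 ?Pm_ge0 1?ltnW //.
by have /andP[] := distort_weight_bounds (Bpart D a p k.+1 (crt k x y)%:Z)
  (@alpha_bounds k.+1 x) (@delta_lt1 k.+1 lt_kn).
Qed.

(** P_(k+1) projects to P_k: its density on the fibre of x depends only on membership in B, and has
    mean 1 there. *)
Lemma Pm_marginal k (x : 'I_(Q k)) : (k < n)%N ->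
  \sum_(y < p k.+1 ^ gam k.+1) P k.+1 (residue D p k.+1 (crt k x y)) = P k x :> R.
Proof.
move=> lt_kn.
have N0 : (p k.+1 ^ gam k.+1)%:R != 0 :> R by rewrite pnatr_eq0 -lt0n fibre_gt0.
under eq_bigr do rewrite PmS //=.
set al := alpha _ _ _; set w1 := Num.max _ _; set w2 := Num.min _ _.
transitivity ((w1 * al + w2 * (1 - al)) * P k x); last first.
  by rewrite distort_weights_mean ?mul1r ?alpha_bounds ?delta_lt1.
(* The weight is the affine function (w1 - w2) 1_B + w2 of the indicator of B, and [alphaE] writes
   [al] as the mean of that indicator, so the identity can be checked term by term. *)
have -> : w1 * al + w2 * (1 - al) = (w1 - w2) * al + w2 by ring.
rewrite /al alphaE // mulrDl mulr_sumr mulr_suml.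
have -> : w2 * P k x
    = \sum_(y < p k.+1 ^ gam k.+1) w2 * (P k x / (p k.+1 ^ gam k.+1)%:R).
  by rewrite sumr_const card_ord -[RHS]mulr_natr -!mulrA mulVf // mulr1.
rewrite -big_split /=; apply: eq_bigr => y _.
by case: Bpart => /=; ring.
Qed.

(** * Multiplicativity of nu(m) / m *)

Lemma nu_ge0 m : 0 <= nu n p delta m.
Proof.
rewrite /nu big_nat_cond prodr_ge0 // => j /andP[jn _].
have /andP[_ ?] := delta_lt1 jn; rewrite divr_ge0 //; lra.
Qed.

Lemma nu1 : nu n p delta 1 = 1.
Proof.
rewrite /nu big_nat_cond big_pred0 // => j.
apply/negP => /andP[/prime_p /prime_gt1]; rewrite dvdn1 => p1 /eqP pE.
by rewrite pE in p1.
Qed.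

Lemma nuM u v : coprime u v ->
  nu n p delta (u * v) = nu n p delta u * nu n p delta v.
Proof.
move=> co_uv; rewrite /nu [LHS]big_mkcond [X in X * _]big_mkcond [X in _ * X]big_mkcond.
rewrite -big_split /=.
apply: eq_big_nat => j jn; have p_pr := prime_p jn.
rewrite Euclid_dvdM //.
case pu: (p j %| u)%N; case pv: (p j %| v)%N => /=; rewrite ?mulr1 ?mul1r //.
have: (p j %| gcdn u v)%N by rewrite dvdn_gcd pu.
by rewrite (eqP co_uv) dvdn1 => /eqP pE; rewrite pE in p_pr.
Qed.

Lemma nu_pX k t : (1 <= k <= n)%N -> (0 < t)%N ->
  nu n p delta (p k ^ t) = 1 / (1 - delta k).
Proof.
move=> kn t_gt0; rewrite /nu big_nat_cond.
rewrite (eq_bigl (fun j => (1 <= j < n.+1)%N && (j == k))); last first.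
  move=> j; case jn: (1 <= j < n.+1)%N => //=.
  rewrite Euclid_dvdX ?prime_p // t_gt0 andbT dvdn_prime2 ?prime_p //.
  by apply/eqP/eqP => [/p_inj -> | ->].
by rewrite -big_nat_cond big_nat1_eq ltnS kn.
Qed.

Lemma nu_ratioM u v : coprime u v -> h (u * v)%N = h u * h v.
Proof. by move=> co_uv; rewrite nuM // natrM invfM; ring. Qed.

Lemma nu_ratio_pX k t : (1 <= k <= n)%N -> (0 < t)%N ->
  h (p k ^ t)%N = 1 / (1 - delta k) * (p k)%:R ^- t.
Proof. by move=> kn t_gt0; rewrite nu_pX // natrX. Qed.

Lemma nu_ratio_ge0 m : 0 <= h m.
Proof. by rewrite divr_ge0 ?nu_ge0. Qed.

(** * The measure of a progression *)

Lemma Qpart_dvdS k d : (k < n)%N -> (d %| Q k.+1)%N ->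
  exists m t, [/\ (m %| Q k)%N, (t <= gam k.+1)%N & d = (m * p k.+1 ^ t)%N].
Proof.
move=> lt_kn; rewrite dvdn_divisors ?Qpart_gt0 // QpartS.
rewrite (perm_mem (perm_divisorsM _ (Qpart_gt0 D p k) (@prime_p k.+1 lt_kn)
  (coprime_QpartS lt_kn))).
case/allpairsP=> [[m t] [mQ tg ->]]; exists m, t; split=> //.
  by rewrite dvdn_divisors ?Qpart_gt0.
by move: tg; rewrite mem_iota add0n ltnS => /andP[].
Qed.

Lemma sum_fibre_class k t e : (k < n)%N -> (t <= gam k.+1)%N ->
  \sum_(y < p k.+1 ^ gam k.+1)
    (y == e %[mod p k.+1 ^ t])%N%:R / (p k.+1 ^ gam k.+1)%:R
    = (p k.+1)%:R ^- t :> R.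
Proof.
move=> lt_kn tg; have q_gt0 := prime_gt0 (@prime_p k.+1 lt_kn).
have q_neq0 : (p k.+1)%:R != 0 :> R by rewrite pnatr_eq0 -lt0n.
rewrite -mulr_suml sum_residue_class ?expn_gt0 ?q_gt0 ?dvdn_exp2l //.
rewrite -expnB // -[X in _ / (_ ^ X)%:R](subnK tg) expnD natrM invfM mulrA.
by rewrite divff ?mul1r natrX // expf_neq0.
Qed.

(* Splitting d = m p^t: if t = 0 the bound is inherited from stage k because  *)
(* the fibres keep their mass, and if t > 0 the pointwise factor              *)
(* 1 / (1 - delta) is exactly the new factor of nu.                           *)
Lemma Pm_AP_le k d e : (k <= n)%N -> (d %| Q k)%N ->
  \sum_(x < Q k) (x == e %[mod d])%N%:R * P k x <= h d.
Proof.
elim: k d e => [|k IH] d e lt_kn dQ.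
  have Q0 : Q 0 = 1%N by rewrite /Qpart big_geq.
  have -> : d = 1%N by move: dQ; rewrite Q0 dvdn1 => /eqP.
  rewrite nu1 divr1 (eq_bigr (fun=> 1)) => [|x _]; last by rewrite !modn1 mulr1.
  by rewrite sumr_const card_ord Q0.
have [m [t [mQ tg dE]]] := Qpart_dvdS lt_kn dQ; rewrite {}dE in dQ *.
have q_gt0 := prime_gt0 (@prime_p k.+1 lt_kn).
have co_mq : coprime m (p k.+1) := coprime_dvdl mQ (coprime_QpartS lt_kn).
rewrite nu_ratioM ?coprimeXr // sum_QpartS //.
have classE (x : 'I_(Q k)) y : (residue D p k.+1 (crt k x y) == e %[mod m * p k.+1 ^ t])%N
    = (x == e %[mod m])%N && (y == e %[mod p k.+1 ^ t])%N.
  by rewrite /= modn_dvdm ?crt_modn.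
case: t tg classE {dQ} => [|t] tg classE.
  rewrite expn0 nu1 divr1 mulr1; apply: le_trans (IH m e (ltnW lt_kn) mQ).
  apply: ler_sum => x _; rewrite -[in leRHS]Pm_marginal // mulr_sumr.
  apply: ler_sum => y _; have := classE x y.
  by rewrite expn0 !modn1 eqxx andbT => ->.
rewrite (@nu_ratio_pX k.+1) //.
have de_gt0 : 0 <= 1 / (1 - delta k.+1).
  by have /andP[_ ?] := @delta_lt1 k.+1 lt_kn; rewrite divr_ge0; lra.
apply: (@le_trans _ _ (\sum_(x < Q k) (x == e %[mod m])%N%:R * P k x
    * (1 / (1 - delta k.+1) * (p k.+1)%:R ^- t.+1))); last first.
  rewrite -mulr_suml ler_wpM2r ?IH 1?ltnW // mulr_ge0 ?invr_ge0 ?exprn_ge0 //.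
apply: ler_sum => x _.
rewrite -(sum_fibre_class e lt_kn tg) !mulr_sumr; apply: ler_sum => y _.
rewrite classE -mulnb natrM -mulrA -[leRHS]mulrA ler_wpM2l //.
rewrite (le_trans (ler_wpM2l _ (PmS_le x y lt_kn))) // le_eqVlt.
by apply/orP; left; apply/eqP; ring.
Qed.

(** * The union bound, expectations and pairs of progressions *)

(** The indicator of B at (x, y) is at most the sum of the indicators of its progressions. Averaging
    over y turns the condition mod p^j into the factor p^-j and leaves the condition on x mod m. *)
Lemma alpha_le k (x : 'I_(Q k)) : (k < n)%N ->
  @alpha R D a p k.+1 x
    <= \sum_(m <- divisors (Q k))
       \sum_(1 <= j < (gam k.+1).+1 | (m * p k.+1 ^ j)%N \in Npart D p k.+1)
         (x == c (m * p k.+1 ^ j) %[mod m])%N%:R * (p k.+1)%:R ^- j.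
Proof.
move=> lt_kn; have q_gt0 := prime_gt0 (@prime_p k.+1 lt_kn).
pose H m j y : R := (x == c (m * p k.+1 ^ j) %[mod m])%N%:R
  * ((y == c (m * p k.+1 ^ j) %[mod p k.+1 ^ j])%N%:R / (p k.+1 ^ gam k.+1)%:R).
have H_ge0 m j y : 0 <= H m j y by rewrite !mulr_ge0 ?invr_ge0.
apply: (@le_trans _ _ (\sum_(y < p k.+1 ^ gam k.+1) \sum_(m <- divisors (Q k))
   \sum_(1 <= j < (gam k.+1).+1 | (m * p k.+1 ^ j)%N \in Npart D p k.+1) H m j y)).
  rewrite alphaE //; apply: ler_sum => y _.
  have S_ge0 m : 0 <= \sum_(1 <= j < (gam k.+1).+1
      | (m * p k.+1 ^ j)%N \in Npart D p k.+1) H m j y.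
    by apply: sumr_ge0.
  case: (boolP (Bpart _ _ _ _ _)) => [/hasP[d dN]|_]; last first.
    by rewrite mul0r sumr_ge0.
  have [m [j [mQ /andP[j_gt0 j_le] dE _]]] :=
    @Npart_decomp D n p k.+1 d p_primes lt_kn dN.
  have m_gt0 := dvdn_gt0 (Qpart_gt0 D p k) mQ.
  rewrite dE AP_nat ?muln_gt0 ?m_gt0 ?expn_gt0 ?q_gt0 // crt_modn //.
  move=> /andP[xm yj].
  (* One progression through (x, y) is enough: its term alone equals the left side, and all other
     terms are nonnegative. *)
  apply: le_trans (ler_sum_term (x := m) _ _ _) => //; last first.
    by rewrite -dvdn_divisors ?Qpart_gt0.
  apply: le_trans (ler_sum_term (x := j) _ _ _) => //.
  - by rewrite /H xm yj !mul1r.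
  - by rewrite mem_index_iota j_gt0 ltnS.
  - by rewrite -dE.
rewrite exchange_big /=; apply: ler_sum => m _.
rewrite exchange_big /= big_nat_cond [leRHS]big_nat_cond; apply: ler_sum => j.
move=> /andP[/andP[_ j_le] _].
by rewrite -mulr_sumr sum_fibre_class.
Qed.

(** Each class mod Q_k has [N] lifts to Z/Q, each carrying a share 1 / N of its mass, so the
    expectation descends to Z/Q_k. *)
Lemma expectE k (f : 'I_(Q k) -> R) : (k <= n)%N -> (0 < Qfull D)%N ->
  expect a p delta k (fun z : 'I_(Qfull D) => f (residue D p k z))
    = \sum_(x < Q k) f x * P k x.
Proof.
move=> le_kn Q_gt0; rewrite /expect /PQ /spread.
have dvQ := Qpart_dvd_Qfull le_kn.
set N := (Qfull D %/ Q k)%N.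
have N0 : N%:R != 0 :> R.
  by rewrite pnatr_eq0 -lt0n divn_gt0 ?Qpart_gt0 // dvdn_leq.
pose G z := f (residue D p k z) * (P k (residue D p k z) / N%:R).
transitivity (\sum_(z < N * Q k) G (z %% Q k)%N).
  by rewrite divnK //; apply: eq_bigr => z _; rewrite /G residue_modn.
rewrite sum_modn -mulr_natr mulr_suml; apply: eq_bigr => x _.
by rewrite /G residue_ord -!mulrA mulVf // mulr1.
Qed.

(** If the two progressions share a point x0, their intersection is the class of x0 modulo the lcm
    and [Pm_AP_le] applies; otherwise the sum is 0. *)
Lemma Pm_AP2_le k d1 d2 e1 e2 : (k <= n)%N -> (d1 %| Q k)%N -> (d2 %| Q k)%N ->
  \sum_(x < Q k) (x == e1 %[mod d1])%N%:R * (x == e2 %[mod d2])%N%:R * P k x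
    <= h (lcmn d1 d2).
Proof.
move=> le_kn d1Q d2Q; under eq_bigr do rewrite -natrM mulnb.
case: (pickP (fun x : 'I_(Q k) => (x == e1 %[mod d1])%N && (x == e2 %[mod d2])%N)).
  move=> x0 /andP[/eqP x01 /eqP x02].
  under eq_bigr do rewrite -x01 -x02 -eqn_mod_lcm.
  by apply: Pm_AP_le; rewrite // dvdn_lcm d1Q.
by move=> none; rewrite big1 ?nu_ratio_ge0 // => x _; rewrite none mul0r.
Qed.

(** * Euler products and their local factors *)

Lemma sum_nu_ratio_fibre_le k : (1 <= k <= n)%N ->
  \sum_(0 <= t < (gam k).+1) h (p k ^ t)%N
    <= 1 + 1 / ((1 - delta k) * ((p k)%:R - 1)).
Proof.
move=> kn; have /andP[_ de_lt1] := delta_lt1 kn.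
rewrite big_ltn // expn0 nu1 divr1 lerD2l.
rewrite (eq_big_nat _ _ (F2 := fun t => 1 / (1 - delta k) * (p k)%:R ^- t)).
  rewrite -mulr_sumr -[X in X / (_ * _)]mulr1 -mulf_div.
  by rewrite ler_wpM2l ?geo_sum_le ?p_gt1 ?divr_ge0 //; lra.
by move=> t /andP[t_gt0 _]; rewrite nu_ratio_pX.
Qed.

Lemma sum_nu_ratio_max_fibre_le k : (1 <= k <= n)%N ->
  \sum_(0 <= s < (gam k).+1) \sum_(0 <= t < (gam k).+1) h (p k ^ maxn s t)%N
    <= 1 + (3 * (p k)%:R - 1) / ((1 - delta k) * ((p k)%:R - 1) ^+ 2).
Proof.
move=> kn; have /andP[_ de_lt1] := delta_lt1 kn.
rewrite (sum_maxn _ (fun r => h (p k ^ r)%N)).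
(* The exponent 0 gives the summand 1; the factor 1 / (1 - delta k) appears only for positive
   exponents. *)
rewrite big_ltn // expn0 nu1 divr1 lerD2l.
rewrite (eq_big_nat _ _ (F2 := fun t =>
  1 / (1 - delta k) * (t.*2.+1%:R * (p k)%:R ^- t))); last first.
  by move=> t /andP[t_gt0 _]; rewrite nu_ratio_pX // -[LHS]mulr_natl mulrCA.
rewrite -mulr_sumr -[X in X / (_ * _)]mul1r -mulf_div.
by rewrite ler_wpM2l ?geo_sum_odd_le ?p_gt1 ?divr_ge0 //; lra.
Qed.

Lemma sum_nu_ratio_le k : (k <= n)%N ->
  \sum_(m <- divisors (Q k)) h m
    <= \prod_(1 <= j < k.+1) (1 + 1 / ((1 - delta j) * ((p j)%:R - 1))).
Proof.
elim: k => [|k IH] lt_kn.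
  by rewrite /Qpart !big_geq // big_seq1 nu1 divr1.
have q_pr := @prime_p k.+1 lt_kn; have co := coprime_QpartS lt_kn.
rewrite QpartS sum_divisorsM ?Qpart_gt0 // big_nat_recr //=.
under eq_big_seq => m.
  rewrite -dvdn_divisors ?Qpart_gt0 // => mQ.
  under eq_bigr do rewrite nu_ratioM ?coprimeXr ?(coprime_dvdl mQ) //.
  rewrite -mulr_sumr; over.
rewrite -mulr_suml ler_pM ?IH 1?ltnW ?sum_nu_ratio_fibre_le //.
  by apply: sumr_ge0 => m _; exact: nu_ratio_ge0.
by apply: sumr_ge0 => m _; exact: nu_ratio_ge0.
Qed.

Lemma sum_nu_ratio_lcm_le k : (k <= n)%N ->
  \sum_(m1 <- divisors (Q k)) \sum_(m2 <- divisors (Q k)) h (lcmn m1 m2)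
    <= \prod_(1 <= j < k.+1)
         (1 + (3 * (p j)%:R - 1) / ((1 - delta j) * ((p j)%:R - 1) ^+ 2)).
Proof.
elim: k => [|k IH] lt_kn.
  by rewrite /Qpart !big_geq // !big_seq1 nu1 divr1.
have q_pr := @prime_p k.+1 lt_kn; have co := coprime_QpartS lt_kn.
set S := (X in X <= _).
have {S}-> : S = (\sum_(m1 <- divisors (Q k)) \sum_(m2 <- divisors (Q k))
      h (lcmn m1 m2)) * \sum_(0 <= s < (gam k.+1).+1)
        \sum_(0 <= t < (gam k.+1).+1) h (p k.+1 ^ maxn s t)%N.
  rewrite /S QpartS sum_divisorsM ?Qpart_gt0 // mulr_suml.
  apply: eq_big_seq => m1; rewrite -dvdn_divisors ?Qpart_gt0 // => m1Q.
  rewrite mulr_sumr; apply: eq_bigr => s _.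
  rewrite sum_divisorsM ?Qpart_gt0 // mulr_suml.
  apply: eq_big_seq => m2; rewrite -dvdn_divisors ?Qpart_gt0 // => m2Q.
  rewrite mulr_sumr; apply: eq_bigr => t _.
  rewrite (lcmn_coprimeMX _ _ (Qpart_gt0 D p k) co m1Q m2Q) nu_ratioM //.
  by rewrite coprimeXr // (coprime_dvdl _ co) // dvdn_lcm m1Q.
rewrite [leRHS]big_nat_recr //= ler_pM ?IH 1?ltnW ?sum_nu_ratio_max_fibre_le //.
  by do 2!apply: sumr_ge0 => ? _; exact: nu_ratio_ge0.
by do 2!apply: sumr_ge0 => ? _; exact: nu_ratio_ge0.
Qed.

(** * The two moments and the closed-form bounds *)

(** [primes 0] is empty, so the existence of a prime p_(k+1) in the list forces positivity. *)
Lemma Qfull_gt0 k : (k < n)%N -> (0 < Qfull D)%N.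
Proof.
move=> lt_kn; have: p k.+1 \in primes (Qfull D).
  by rewrite -(perm_mem p_primes) map_f // mem_iota.
by rewrite mem_primes => /and3P[].
Qed.

Lemma M1_le k : (k < n)%N ->
  M1 D a p delta k.+1
    <= \sum_(m <- divisors (Q k))
       \sum_(1 <= j < (gam k.+1).+1 | (m * p k.+1 ^ j)%N \in Npart D p k.+1)
         (p k.+1)%:R ^- j * h m.
Proof.
move=> lt_kn.
rewrite [M1 _ _ _ _ _](expectE (@alpha R D a p k.+1) (ltnW lt_kn) (Qfull_gt0 lt_kn)).
have leS x := ler_wpM2r (@Pm_ge0 k x (ltnW lt_kn)) (@alpha_le k x lt_kn).
apply: le_trans (ler_sum _ (fun x _ => leS x)) _.
under eq_bigr do rewrite mulr_suml.
rewrite exchange_big /=; apply: ler_sum_seq => m.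
rewrite -dvdn_divisors ?Qpart_gt0 // => mQ.
under eq_bigr do rewrite mulr_suml.
rewrite exchange_big /=; apply: ler_sum => j _.
under eq_bigr do rewrite mulrAC mulrC.
by rewrite -mulr_sumr ler_wpM2l ?invr_ge0 ?exprn_ge0 ?Pm_AP_le // ltnW.
Qed.

Lemma M2_le k : (k < n)%N ->
  M2 D a p delta k.+1
    <= \sum_(m1 <- divisors (Q k))
       \sum_(1 <= j1 < (gam k.+1).+1 | (m1 * p k.+1 ^ j1)%N \in Npart D p k.+1)
       \sum_(m2 <- divisors (Q k))
       \sum_(1 <= j2 < (gam k.+1).+1 | (m2 * p k.+1 ^ j2)%N \in Npart D p k.+1)
         (p k.+1)%:R ^- (j1 + j2) * h (lcmn m1 m2).
Proof.
move=> lt_kn.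
rewrite [M2 _ _ _ _ _](expectE (fun x => @alpha R D a p k.+1 x ^+ 2)
  (ltnW lt_kn) (Qfull_gt0 lt_kn)).
under eq_bigr do rewrite expr2.
have al_ge0 x : 0 <= @alpha R D a p k.+1 x by have /andP[] := @alpha_bounds k.+1 x.
(* Multiplying the union bound by itself produces the sum over ordered pairs of elements of N_i. *)
have leS x := ler_wpM2r (@Pm_ge0 k x (ltnW lt_kn)) (ler_pM (al_ge0 x) (al_ge0 x)
  (@alpha_le k x lt_kn) (@alpha_le k x lt_kn)).
apply: le_trans (ler_sum _ (fun x _ => leS x)) _.
under eq_bigr do rewrite -mulrA mulr_suml.
rewrite exchange_big /=; apply: ler_sum_seq => m1.
rewrite -dvdn_divisors ?Qpart_gt0 // => m1Q.
under eq_bigr do rewrite mulr_suml.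
rewrite exchange_big /=; apply: ler_sum => j1 _.
under eq_bigr do rewrite mulr_suml mulr_sumr.
rewrite exchange_big /=; apply: ler_sum_seq => m2.
rewrite -dvdn_divisors ?Qpart_gt0 // => m2Q.
under eq_bigr do rewrite mulr_suml mulr_sumr.
rewrite exchange_big /=; apply: ler_sum => j2 _.
set e1 := c _; set e2 := c _.
under eq_bigr => x _.
  rewrite (_ : _ * _ = (p k.+1)%:R ^- (j1 + j2) * ((x == e1 %[mod m1])%N%:R
    * (x == e2 %[mod m2])%N%:R * P k x)); last by rewrite exprD invfM; ring.
  over.
by rewrite -mulr_sumr ler_wpM2l ?invr_ge0 ?exprn_ge0 ?Pm_AP2_le // ltnW.
Qed.

Lemma M1_sum_le k : (k < n)%N ->
  \sum_(m <- divisors (Q k))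
    \sum_(1 <= j < (gam k.+1).+1 | (m * p k.+1 ^ j)%N \in Npart D p k.+1)
      (p k.+1)%:R ^- j * h m
    <= 1 / ((p k.+1)%:R - 1)
       * \prod_(1 <= j < k.+1) (1 + 1 / ((1 - delta j) * ((p j)%:R - 1))).
Proof.
move=> lt_kn; pose x : R := (p k.+1)%:R.
have x_ge0 j : 0 <= x ^- j by rewrite invr_ge0 exprn_ge0.
(* Without the restriction to N_i the sum over (m, j) is a product of a geometric sum in j and a
   divisor sum in m; all added terms are nonnegative. *)
apply: (@le_trans _ _ ((\sum_(1 <= j < (gam k.+1).+1) x ^- j)
    * \sum_(m <- divisors (Q k)) h m)).
  rewrite mulr_sumr; apply: ler_sum => m _; rewrite mulr_suml.
  by apply: ler_sum_subset => j; rewrite mulr_ge0 ?nu_ratio_ge0.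
apply: ler_pM; rewrite ?sum_nu_ratio_le ?geo_sum_le ?(@p_gt1 k.+1) ?(ltnW lt_kn) //.
  exact: sumr_ge0.
by apply: sumr_ge0 => m _; exact: nu_ratio_ge0.
Qed.

Lemma M2_sum_le k : (k < n)%N ->
  \sum_(m1 <- divisors (Q k))
  \sum_(1 <= j1 < (gam k.+1).+1 | (m1 * p k.+1 ^ j1)%N \in Npart D p k.+1)
  \sum_(m2 <- divisors (Q k))
  \sum_(1 <= j2 < (gam k.+1).+1 | (m2 * p k.+1 ^ j2)%N \in Npart D p k.+1)
    (p k.+1)%:R ^- (j1 + j2) * h (lcmn m1 m2)
    <= 1 / ((p k.+1)%:R - 1) ^+ 2
       * \prod_(1 <= j < k.+1)
           (1 + (3 * (p j)%:R - 1) / ((1 - delta j) * ((p j)%:R - 1) ^+ 2)).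
Proof.
move=> lt_kn; pose x : R := (p k.+1)%:R.
have x_ge0 j : 0 <= x ^- j by rewrite invr_ge0 exprn_ge0.
have nu_ratio_ge0' := nu_ratio_ge0.
apply: (@le_trans _ _ ((\sum_(1 <= j < (gam k.+1).+1) x ^- j) ^+ 2
    * \sum_(m1 <- divisors (Q k)) \sum_(m2 <- divisors (Q k)) h (lcmn m1 m2))).
  rewrite expr2 -mulrA mulr_sumr mulr_sumr; apply: ler_sum => m1 _.
  rewrite mulr_suml; apply: le_trans (ler_sum_subset _ _ _) _ => [j1|].
    by do 2!(apply: sumr_ge0 => ? _); rewrite mulr_ge0 ?nu_ratio_ge0.
  apply: ler_sum => j1 _; rewrite !mulr_sumr; apply: ler_sum => m2 _.
  rewrite mulr_suml mulr_sumr.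
  apply: le_trans (ler_sum_subset _ _ _) _ => [j2|].
    by rewrite mulr_ge0 ?nu_ratio_ge0.
  by apply: ler_sum => j2 _; rewrite exprD invfM -mulrA.
have s_ge0 : 0 <= \sum_(1 <= j < (gam k.+1).+1) x ^- j by exact: sumr_ge0.
apply: ler_pM; rewrite ?sum_nu_ratio_lcm_le ?exprn_ge0 ?(ltnW lt_kn) //.
  by do 2!(apply: sumr_ge0 => ? _); exact: nu_ratio_ge0.
rewrite -[X in X / _](expr1n _ 2) -expr_div_n lerXn2r ?nnegrE //.
  by rewrite (le_trans s_ge0) // geo_sum_le // (@p_gt1 k.+1).
by rewrite geo_sum_le // (@p_gt1 k.+1).
Qed.

End Distortion.

Theorem theorem3p2 (R : realFieldType) (D : {fset nat}) (a : nat -> int)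
    (n : nat) (p : nat -> nat) (delta : nat -> R)
    (D_gt1 : forall d : nat, d \in D -> (1 < d)%N)
    (p_primes : perm_eq [seq p j | j <- iota 1 n] (primes (Qfull D)))
    (delta_bounds : forall j : nat, (1 <= j <= n)%N -> 0 <= delta j <= 1 / 2)
    (i : nat) (i_bounds : (1 <= i <= n)%N) :
  (M1 D a p delta i
     <= \sum_(m <- divisors (Qpart D p i.-1))
           \sum_(1 <= j < (gamma D p i).+1 | (m * p i ^ j)%N \in Npart D p i)
             (p i)%:R ^- j * (nu n p delta m / m%:R)
     <= 1 / ((p i)%:R - 1)
        * \prod_(1 <= j < i) (1 + 1 / ((1 - delta j) * ((p j)%:R - 1))))
  /\
  (M2 D a p delta i
     <= \sum_(m1 <- divisors (Qpart D p i.-1))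
        \sum_(1 <= j1 < (gamma D p i).+1 | (m1 * p i ^ j1)%N \in Npart D p i)
        \sum_(m2 <- divisors (Qpart D p i.-1))
        \sum_(1 <= j2 < (gamma D p i).+1 | (m2 * p i ^ j2)%N \in Npart D p i)
          (p i)%:R ^- (j1 + j2)
          * (nu n p delta (lcmn m1 m2) / (lcmn m1 m2)%:R)
     <= 1 / ((p i)%:R - 1) ^+ 2
        * \prod_(1 <= j < i)
            (1 + (3 * (p j)%:R - 1) / ((1 - delta j) * ((p j)%:R - 1) ^+ 2))).
Proof.
case: i i_bounds => // k lt_kn; rewrite /= in lt_kn *.
split; apply/andP; split.
- exact: M1_le.
- exact: M1_sum_le.
- exact: M2_le.
- exact: M2_sum_le.
Qed.
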